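(* For each integer $n\ge 1$ let $\pi$ be a uniformly random permutation of the set $\{0,1,\dots,2^n-1\}$, and let $E_\pi(s)$ denote the ground state energy (lowest eigenvalue) of $H_\pi(s)$. Let $$e(s)=\begin{cases}\frac{s}{2} & \text{for } 0\le s\le \frac12,\\ \frac{1-s}{2} & \text{for } \frac12\le s\le 1.\end{cases}$$ Then (for every value of the permutation $\pi$) $$\frac{E_\pi(s)}{n}\le e(s)\quad\text{for all } 0\le s\le 1,$$ and $$\Pr\left[\frac{E_\pi(s)}{n}\ge e(s)\left[1-5n^{-1/4}\right]\text{ for all }0\le s\le 1\right]\longrightarrow 1\quad\text{as } n\to\infty.$$
   Context: Fix $n\ge1$. Identify the integers $z\in\{0,1,\dots,2^n-1\}$ with $n$-bit strings via binary expansion, and let $W(z)$ be the Hamming weight of $z$ (the number of ones in the string). Let $\{|z\rangle\}$ be the standard orthonormal basis of $(\mathbb{C}^2)^{\otimes n}\cong\mathbb{C}^{2^n}$ indexed by $n$-bit strings. Let $\sigma_x^i$ be the Pauli $x$ operator acting on the $i$-th qubit, i.e. $\sigma_x^i|z\rangle=|z\oplus e_i\rangle$, where $z\oplus e_i$ is $z$ with its $i$-th bit flipped. For a permutation $\pi$ of $\{0,1,\dots,2^n-1\}$ (a permutation of the $2^n$ strings, not of the $n$ bits) and real $s$, define the Hermitian operator $$H_\pi(s)=(1-s)\sum_{i=1}^n\left(\frac{1-\sigma_x^i}{2}\right)+s\sum_{z=0}^{2^n-1}W(\pi^{-1}(z))\,|z\rangle\langle z|.$$ Probabilities are over $\pi$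 chosen uniformly from all $(2^n)!$ permutations. *)

(* Defs.v *)
From mathcomp Require Import all_boot all_order all_algebra all_fingroup.
From mathcomp Require Import complex spectral.
From mathcomp Require Import all_classical all_reals all_analysis.

Set Implicit Arguments.
Unset Strict Implicit.
Unset Printing Implicit Defensive.

Import Order.TTheory GRing.Theory Num.Theory.
Import numFieldNormedType.Exports.

Local Open Scope ring_scope.
Local Open Scope complex_scope.

Section Strings.

(* The i-th binary digit of z, digit 0 being the least significant one. *)
Definition bit (i z : nat) : bool := odd (z %/ 2 ^ i).

Definition hamming_weight (n : nat) (z : 'I_(2 ^ n)) : nat :=
  (\sum_(i < n) bit i z)%N.

(* w = z (+) e_i, as n-bit strings. *)
Definition is_flip (n : nat) (i : 'I_n) (w z : 'I_(2 ^ n)) : bool :=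
  [forall j : 'I_n, bit j w == bit j z (+) (j == i)].

End Strings.

Section Hamiltonian.
Variable R : realType.

(* The entry <w| sigma_x^i |z>, for sigma_x^i |z> = |z (+) e_i>. *)
Definition sigma_x (n : nat) (i : 'I_n) : 'M[R[i]]_(2 ^ n) :=
  \matrix_(w, z) (is_flip i w z)%:R.

Definition ket_bra (m : nat) (z : 'I_m) : 'M[R[i]]_m := delta_mx z z.

Definition hamiltonian (n : nat) (pi : 'S_(2 ^ n)) (s : R) : 'M[R[i]]_(2 ^ n) :=
  (1 - s)%:C *: (\sum_(i < n) 2^-1 *: (1%:M - sigma_x i))
  + s%:C *: (\sum_z (hamming_weight ((pi^-1)%g z))%:R *: ket_bra z).

(* The lowest eigenvalue: for a Hermitian matrix this infimum is a minimum and every eigenvalue is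
   real: see ground_energyP. *)
Definition ground_energy (m : nat) (A : 'M[R[i]]_m) : R :=
  inf [set x : R | eigenvalue A x%:C]%classic.

Definition energy_profile (s : R) : R :=
  if s <= 2^-1 then s / 2 else (1 - s) / 2.

End Hamiltonian.

(* The probability of P under the uniform distribution on T. *)
Definition uniform_prob_of (R : realType) (T : finType) (P : T -> Prop) : R :=
  #|[pred x | `[< P x >]]|%:R / #|T|%:R.

Section Sanity.
Variable R : realType.

Lemma is_flip_sym (n : nat) (i : 'I_n) (w z : 'I_(2 ^ n)) :
  is_flip i w z = is_flip i z w.
Proof.
apply: eq_forallb => j.
by case: (bit j w); case: (bit j z); case: (j == i).
Qed.

Lemma hamiltonian_herm (n : nat) (pi : 'S_(2 ^ n)) (s : R) :
  hamiltonian pi s \is hermsymmx.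
Proof.
apply: realsym_hermsym.
  apply/is_hermitianmxP; rewrite expr0 scale1r map_mx_id //.
  apply/matrixP => w z; rewrite !(mxE, summxE).
  congr (_ * _ + _ * _); apply: eq_bigr => i _; rewrite !mxE.
    by rewrite is_flip_sym eq_sym.
  by rewrite andbC.
have realC (x : R) : x%:C \is Num.real.
  by apply/complex_realP; exists x.
apply/mxOverP => w z; rewrite !(mxE, summxE).
apply: realD; apply: realM => //; apply: sum_real => i _; rewrite !mxE.
  apply: realM; first by rewrite realV realn.
  by apply: realB; rewrite ?realn // ?mulrb; case: ifP; rewrite ?real0 ?real1.
by apply: realM; rewrite realn.
Qed.

Lemma eigenvalue_spectral (C : numClosedFieldType) (m : nat)
    (A : 'M[C]_m) (a : C) :
  A \is hermsymmx ->
  reflect (exists i, a = spectral_diag A 0 i) (eigenvalue A a).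
Proof.
move=> hA; have /hermitian_normalmx/orthomx_spectralP := hA.
have : spectralmx A \in unitmx by rewrite unitarymx_unit ?spectral_unitarymx.
move: (spectralmx A) (spectral_diag A) => P d uP eA.
have PA : P *m A = diag_mx d *m P by rewrite eA !mulmxA mulmxV // mul1mx.
apply: (iffP eigenvalueP) => [[v vA v0]|[i ->]].
  pose w := v *m invmx P.
  have wD : w *m diag_mx d = a *: w.
    by rewrite /w scalemxAl -vA eA !mulmxA mulmxK.
  have w0 : w != 0.
    by apply: contra_neq v0 => w0; rewrite -[v](mulmxKV uP) -/w w0 mul0mx.
  move: (w) wD w0 => {vA v0}u uD u0.
  have [i ui] : exists i, u 0 i != 0.
    apply/existsP; apply: contraNT u0; rewrite negb_exists => /forallP u0.
    by apply/eqP/rowP => i; rewrite mxE; apply/eqP; have := u0 i; rewrite negbK.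
  exists i; move/rowP: uD => /(_ i); rewrite mul_mx_diag !mxE mulrC => /eqP.
  by rewrite (inj_eq (mulIf ui)) => /eqP.
exists (row i P).
  by rewrite -row_mul PA row_mul row_diag_mx -scalemxAl -rowE.
apply: contraTneq uP => r0; rewrite -row_free_unit.
apply/negP => /row_freeP[B PB]; move/row_matrixP: PB => /(_ i).
rewrite row_mul r0 mul0mx row1 => /rowP/(_ i)/eqP.
by rewrite !mxE !eqxx eq_sym oner_eq0.
Qed.

Lemma ground_energyP (m : nat) (A : 'M[R[i]]_m) :
  (0 < m)%N -> A \is hermsymmx ->
  eigenvalue A (ground_energy A)%:C /\
  forall a : R[i], eigenvalue A a -> (ground_energy A)%:C <= a.
Proof.
case: m A => // m A _ hA.
pose d i : R := complex.Re (spectral_diag A 0 i).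
have dE i : spectral_diag A 0 i = (d i)%:C.
  have /mxOverP/(_ 0 i) := hermitian_spectral_diag_real hA.
  by rewrite /d => /complex_realP[x ->].
pose i0 := [arg min_(i < ord0) d i]%O.
have i0P i : d i0 <= d i by rewrite /i0; case: arg_minP => // j _; apply.
have eig i : eigenvalue A (d i)%:C.
  by rewrite -dE; apply/eigenvalue_spectral => //; exists i.
have eP (a : R[i]) : eigenvalue A a -> exists i, a = (d i)%:C.
  move=> ea; have [i ->] := elimT (eigenvalue_spectral a hA) ea.
  by exists i; rewrite dE.
have lb : lbound [set x : R | eigenvalue A x%:C]%classic (d i0).
  by move=> x /= /eP[i [->]].
have E : ground_energy A = d i0.
  apply/eqP; rewrite eq_le; apply/andP; split.
    by apply: ge_inf; [exists (d i0) | exact: eig].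
  by apply: lb_le_inf => //; exists (d i0); exact: eig.
rewrite E; split => // a /eP[i ->].
by rewrite lecR.
Qed.

End Sanity.

(* Main.v *)
(* Upper bound: the uniform superposition has energy n s / 2, the basis state at pi(0) has energy
   n (1 - s) / 2. Lower bound: the ground energy is concave in s and nonnegative at s = 0 and s = 1,
   so it suffices to treat s = 1/2. Put x = n^(1/4), and let S be the set of strings of weight below
   n/2 - 3/2 x^3; its density is at most exp(-x^2). With high probability every vertex of the cube has
   at most 8 x^2 neighbours in pi(S). The off-diagonal entries of the Hamiltonian are nonpositive, so
   a positive f with H f >= l f pointwise forces E >= l; take f = x/4 on pi(S) and f = 1 elsewhere. *)
Require Import Defs.
From mathcomp Require Import all_boot all_order all_algebra all_fingroup.
From mathcomp Require Import complex spectral ring lra.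
From mathcomp Require Import all_classical all_reals all_analysis.
Set Implicit Arguments.
Unset Strict Implicit.
Unset Printing Implicit Defensive.
Import Order.TTheory GRing.Theory Num.Theory.
Import numFieldNormedType.Exports.
Local Open Scope ring_scope.

(** * Binary strings, bit flips and the total Hamming weight *)

Definition bits (n : nat) (z : 'I_(2 ^ n)) : {ffun 'I_n -> bool} :=
  [ffun i => bit (nat_of_ord i) z].

Lemma bit0 (z : nat) : bit 0 z = odd z.
Proof. by rewrite /bit divn1. Qed.

Lemma bitS (i z : nat) : bit i.+1 z = bit i z./2.
Proof. by rewrite /bit expnS divnMA divn2. Qed.

Lemma bits_inj (n : nat) : injective (@bits n).
Proof.
move=> z w /ffunP zw; apply: val_inj => /=.
have {zw} : forall i, (i < n)%N -> bit i z = bit i w.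
  by move=> i ltin; have := zw (Ordinal ltin); rewrite !ffunE.
move: (nat_of_ord z) (nat_of_ord w) (ltn_ord z) (ltn_ord w) => {z w}.
elim: n => [|n IHn] z w ltz ltw zw.
  by move: ltz ltw; rewrite expn0 !ltnS !leqn0 => /eqP-> /eqP->.
have half_lt u : (u < 2 ^ n.+1)%N -> (u./2 < 2 ^ n)%N.
  by rewrite -divn2 ltn_divLR // -expnSr.
rewrite -(odd_double_half z) -(odd_double_half w) -!bit0 zw //.
by rewrite (IHn z./2 w./2) ?half_lt // => i ltin; rewrite -!bitS zw.
Qed.

Lemma bits_bij (n : nat) : bijective (@bits n).
Proof.
by apply: (inj_card_bij (@bits_inj n)); rewrite card_ffun card_bool !card_ord.
Qed.

(** The default [z] is never reached: [bits] is onto, so the string with bit [i] flipped always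
    exists ([is_flipE]). *)
Definition flip (n : nat) (i : 'I_n) (z : 'I_(2 ^ n)) : 'I_(2 ^ n) :=
  odflt z [pick w | is_flip i w z].

Lemma is_flipE (n : nat) (i : 'I_n) (w z : 'I_(2 ^ n)) :
  is_flip i w z = (w == flip i z).
Proof.
have uniq_flip u v : is_flip i u z -> is_flip i v z -> u = v.
  move=> /forallP fu /forallP fv; apply: bits_inj; apply/ffunP => j.
  by rewrite !ffunE (eqP (fu j)) (eqP (fv j)).
rewrite /flip; case: pickP => [u fu | noflip] /=.
  by apply/idP/eqP => [fw|->//]; apply: uniq_flip.
have [g bK gK] := bits_bij n.
have := noflip (g [ffun j => bit (nat_of_ord j) z (+) (j == i)]).
move/negbT/forallP; case=> j; apply/eqP.
set u := g _; have /ffunP/(_ j) : bits u = [ffun j : 'I_n => bit j z (+) (j == i)].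
  by rewrite gK.
by rewrite !ffunE.
Qed.

Lemma bit_flip (n : nat) (i j : 'I_n) (z : 'I_(2 ^ n)) :
  bit j (flip i z) = bit j z (+) (j == i).
Proof.
have : is_flip i (flip i z) z by rewrite is_flipE.
by move=> /forallP/(_ j)/eqP.
Qed.

Lemma flip_neq (n : nat) (i : 'I_n) (z : 'I_(2 ^ n)) : flip i z != z.
Proof.
apply/eqP => /(congr1 (fun w : 'I__ => bit i w)).
by rewrite bit_flip eqxx; case: (bit _ _).
Qed.

Lemma flip_inj (n : nat) (z : 'I_(2 ^ n)) : injective (fun i => flip i z).
Proof.
move=> i j /(congr1 (fun w : 'I__ => bit i w)); rewrite !bit_flip eqxx.
by case: eqP => // _; case: (bit _ _).
Qed.

(** For each bit [i], the involution [flip i] pairs a string having that bit set with one that does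
    not, so the bit is set in half of all strings. *)
Lemma sum_hamming_weight (n : nat) :
  (2 * \sum_(z < 2 ^ n) hamming_weight z = n * 2 ^ n)%N.
Proof.
have flipK (i : 'I_n) : involutive (flip i).
  move=> z; apply: bits_inj; apply/ffunP => j.
  by rewrite !ffunE !bit_flip; case: (bit _ _); case: (j == i).
rewrite exchange_big big_distrr /=.
rewrite (eq_bigr (fun=> 2 ^ n)%N) => [|i _].
  by rewrite sum_nat_const card_ord.
rewrite mul2n -addnn {2}(reindex_inj (inv_inj (flipK i))) -big_split /=.
rewrite (eq_bigr (fun=> 1%N)) => [|z _]; first by rewrite sum1_card card_ord.
by rewrite bit_flip eqxx; case: (bit _ _).
Qed.

(** * Lower tail of the Hamming weight *)

(** The weight is a sum over independent bits, so the exponential sum factors into [n] equal sums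
    over one bit. *)
Lemma hamming_weight_mgf (R : realType) (n : nat) (t : R) :
  \sum_(z < 2 ^ n) expR (- t * (hamming_weight z)%:R) = (1 + expR (- t)) ^+ n.
Proof.
pose F (b : bool) : R := expR (- t * b%:R).
have -> : 1 + expR (- t) = \sum_b F b.
  by rewrite big_bool /F mulr1 mulr0 expR0 addrC.
rewrite -[X in _ ^+ X]card_ord -prodr_const bigA_distr_bigA.
rewrite (reindex (@bits n)) /=; last exact: onW_bij (bits_bij n).
apply: eq_bigr => z _; rewrite /hamming_weight natr_sum mulr_sumr expR_sum.
by apply: eq_bigr => i _; rewrite ffunE.
Qed.

(** Chernoff bound with parameter [t = 1/x]. With [n = x^4], the generating function contributes the
    exponent [x^2/2 - x^3/2] and the threshold contributes [t * c = x^3/2 - 3/2 x^2]; together they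
    give [-x^2]. *)
Lemma low_weight_tail (R : realType) (n : nat) (x : R) :
  1 <= x -> x ^+ 4 = n%:R ->
  #|[set z : 'I_(2 ^ n) |
      (hamming_weight z)%:R < x ^+ 4 / 2 - 3 / 2 * x ^+ 3]|%:R
    <= 2 ^+ n * expR (- x ^+ 2) :> R.
Proof.
move=> x1 xn; set S := finset _.
have x0 : 0 < x by lra.
pose t := x^-1; pose c : R := x ^+ 4 / 2 - 3 / 2 * x ^+ 3.
have t0 : 0 < t by rewrite invr_gt0.
have S_mgf : #|S|%:R * expR (- t * c) <= (1 + expR (- t)) ^+ n.
  rewrite -hamming_weight_mgf (bigID (mem S)) /= mulr_natl -sumr_const.
  rewrite -[leLHS]addr0; apply: lerD; last first.
    by apply: sumr_ge0 => z _; rewrite expR_ge0.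
  apply: ler_sum => z; rewrite inE => zS.
  by rewrite ler_expR !mulNr lerN2 ler_pM2l // ltW.
(* From [exp(-t) <= 1/(1+t) <= 1 - t + t^2] the left side is at most [2 (1 - t/2 + t^2/2)], and
   [1 + u <= exp u] finishes. *)
have base : 1 + expR (- t) <= 2 * expR (- t / 2 + t ^+ 2 / 2).
  have eNt : expR (- t) <= 1 - t + t ^+ 2.
    rewrite expRN (le_trans (_ : _ <= (1 + t)^-1)) //.
      by rewrite lef_pV2 ?posrE ?expR_gt0 ?expR_ge1Dx //; lra.
    rewrite -div1r ler_pdivrMr; last by lra.
    have -> : (1 - t + t ^+ 2) * (1 + t) = 1 + t ^+ 3 by ring.
    by rewrite lerDl exprn_ge0 // ltW.
  have := expR_ge1Dx (- t / 2 + t ^+ 2 / 2); lra.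
have {}S_mgf : #|S|%:R * expR (- t * c) <= 2 ^+ n * expR (x ^+ 2 / 2 - x ^+ 3 / 2).
  apply: (le_trans S_mgf).
  apply: (le_trans (lerXn2r _ _ _ base)); rewrite ?nnegrE.
  - by rewrite addr_ge0 ?expR_ge0.
  - by rewrite mulr_ge0 ?expR_ge0.
  rewrite exprMn -expRM_natl -xn le_eqVlt; apply/orP; left; apply/eqP.
  by congr (_ * expR _); rewrite /t; field; lra.
have -> : #|S|%:R = #|S|%:R * expR (- t * c) * expR (t * c) :> R.
  by rewrite -mulrA -expRD mulNr addNr expR0 mulr1.
apply: (le_trans (ler_wpM2r (expR_ge0 _) S_mgf)).
rewrite -mulrA -expRD le_eqVlt; apply/orP; left; apply/eqP.
by congr (_ * expR _); rewrite /t /c; field; lra.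
Qed.

(** * Random permutations mapping a set into another *)

(* Composing with a transposition shows that the count is the same for every t outside A; the
   factors then come from summing it over all such t. *)
Lemma perm_preim_count_step (T : finType) (S A : {set T}) (t : T) :
  t \notin A ->
  ((#|T| - #|A|) * #|[set p : {perm T} | p @: (t |: A) \subset S]|
   = (#|S| - #|A|) * #|[set p : {perm T} | p @: A \subset S]|)%N.
Proof.
move=> tA.
have swap u : u \notin A ->
    #|[set p : {perm T} | p @: (u |: A) \subset S]|
    = #|[set p : {perm T} | p @: (t |: A) \subset S]|.
  move=> uA; transitivity #|[set (tperm t u * p)%g | p : {perm T} in
      [set p : {perm T} | p @: (u |: A) \subset S]]|.
    by rewrite card_imset //; exact: mulgI.
  apply: eq_card => p; rewrite -[p](mulKVg (tperm t u)).
  rewrite mem_imset; last exact: mulgI.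
  rewrite !inE tpermV; set q := (_ * p)%g.
  suff -> : (tperm t u * q)%g @: (t |: A) = q @: (u |: A) by [].
  rewrite !imsetU1 permM tpermL; congr (_ |: _).
  apply: eq_in_imset => a aA; rewrite permM tpermD //.
    by apply: contraNneq tA => ->.
  by apply: contraNneq uA => ->.
transitivity (\sum_(u in ~: A) #|[set p : {perm T} | p @: (u |: A) \subset S]|)%N.
  rewrite (eq_bigr (fun=> #|[set p : {perm T} | p @: (t |: A) \subset S]|)).
    by rewrite sum_nat_const (cardsCs (~: A)) finset.setCK.
  by move=> u; rewrite inE => /swap.
transitivity (\sum_(p : {perm T} | p @: A \subset S) \sum_(u in ~: A | p u \in S) 1)%N.
  rewrite (exchange_big_dep (fun u => u \in ~: A)) /=; last by move=> p u _ /andP[].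
  apply: eq_bigr => u uA; rewrite -sum1_card.
  by apply: eq_bigl => p; rewrite inE imsetU1 finset.subUset finset.sub1set uA andbC.
rewrite (eq_bigr (fun=> #|S| - #|A|)%N) => [|p pAS].
  by rewrite sum_nat_const mulnC; congr (_ * _)%N; apply: eq_card => p; rewrite inE.
rewrite sum1_card -(card_imset A (@perm_inj _ p)).
have -> : (#|S| - #|p @: A| = #|S :\: p @: A|)%N.
  by rewrite cardsD (finset.setIidPr pAS).
rewrite -[RHS](card_preimset _ (@perm_inj _ p)); apply: eq_card => u.
by rewrite !inE (mem_imset _ _ (@perm_inj _ p)) unfold_in /= !inE.
Qed.

(** This is sampling without replacement: when [k] points already lie in [S], the next one does so
    with probability [(|S| - k) / (|T| - k)], which is at most [|S| / |T|]. *)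
Lemma perm_preim_count (R : realType) (T : finType) (S A : {set T}) :
  (0 < #|T|)%N ->
  #|[set p : {perm T} | p @: A \subset S]|%:R
    <= (#|S|%:R / #|T|%:R) ^+ #|A| * #|{perm T}|%:R :> R.
Proof.
move=> T0; set r : R := _ / _.
have r0 : 0 <= r by rewrite divr_ge0.
move cardA: #|A| => k; elim: k A cardA => [|k IHk] A cardA.
  by rewrite expr0 mul1r ler_nat; apply: max_card.
have /card_gt0P[t tA] : (0 < #|A|)%N by rewrite cardA.
have cardA' : #|A :\ t| = k by move: cardA; rewrite (cardsD1 t) tA => -[].
have tA' : t \notin A :\ t by rewrite !inE eqxx.
have := perm_preim_count_step S tA'; rewrite finset.setD1K // cardA'.
have kT : (k < #|T|)%N by rewrite -cardA; exact: max_card.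
set c := #|_| => /(congr1 (fun u => u%:R : R)); rewrite !natrM => step.
have d0 : 0 < (#|T| - k)%:R :> R by rewrite ltr0n subn_gt0.
rewrite -(ler_pM2l d0) step exprS -!mulrA.
apply: (@le_trans _ _ ((#|S| - k)%:R * (r ^+ k * #|{perm T}|%:R))).
  by rewrite ler_wpM2l // IHk.
rewrite !mulrA ler_wpM2r // ler_wpM2r ?exprn_ge0 //.
(* The subtraction [#|S| - k] is truncated, and the inequality reduces to [k * #|S| <= k * #|T|] in
   either case. *)
rewrite ler_pdivlMr ?ltr0n // -!natrM ler_nat.
rewrite !mulnBl [(#|T| * _)%N]mulnC leq_sub2l // leq_mul //.
exact: max_card.
Qed.

(** * Variational bounds for the ground energy of a Hermitian matrix *)

(** Row vectors match the convention [v *m A = a *: v] of [eigenvalue]. Vectors are not normalised: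
    [qform 1%:M v] is the squared norm of [v]. *)
Definition qform (R : realType) (m : nat) (A : 'M[R[i]]_m) (v : 'rV[R[i]]_m) : R[i] :=
  (v *m A *m v ^t*)%sesqui 0 0.

Lemma qform_lin (R : realType) (m : nat) (a b : R[i]) (A B : 'M[R[i]]_m)
    (v : 'rV[R[i]]_m) :
  qform (a *: A + b *: B) v = a * qform A v + b * qform B v.
Proof.
rewrite /qform mulmxDr -!scalemxAr mulmxDl -!scalemxAl mxE.
by congr (_ + _); rewrite mxE.
Qed.

Lemma qform_eigenvector (R : realType) (m : nat) (A : 'M[R[i]]_m)
    (v : 'rV[R[i]]_m) (a : R[i]) :
  v *m A = a *: v -> qform A v = a * qform 1%:M v.
Proof. by rewrite /qform mulmx1 => ->; rewrite -scalemxAl mxE. Qed.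

Lemma qform1_gt0 (R : realType) (m : nat) (v : 'rV[R[i]]_m) :
  v != 0 -> 0 < qform 1%:M v.
Proof.
move=> v0; rewrite /qform mulmx1 -dotmxE lt_def dnorm_eq0 v0 /=.
exact: dnorm_ge0.
Qed.

(** In an orthonormal eigenbasis the form is a sum of eigenvalues with weights [|w_i|^2], and each
    eigenvalue is at least the lowest one. *)
Lemma rayleigh_ge (R : realType) (m : nat) (A : 'M[R[i]]_m) (v : 'rV[R[i]]_m) :
  A \is hermsymmx -> (ground_energy A)%:C%C * qform 1%:M v <= qform A v.
Proof.
rewrite /qform mulmx1.
case: m A v => [|m] A v hA.
  by rewrite !mxE !big_ord0 mulr0.
have [_ Emin] := ground_energyP (ltn0Sn m) hA.
have /hermitian_normalmx/orthomx_spectralP := hA.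
have uP := spectral_unitarymx A.
have eig i : eigenvalue A (spectral_diag A 0 i).
  by apply/eigenvalue_spectral => //; exists i.
move: (spectralmx A) (spectral_diag A) uP eig => P d uP eig AE.
pose w := v *m (P ^t*)%sesqui.
have wE : (w ^t* = P *m v ^t*)%sesqui.
  by rewrite /w trmx_mul map_mxM /= trmxCK.
have -> : (v *m v ^t* = w *m w ^t*)%sesqui.
  rewrite wE /w -invmx_unitary // !mulmxA mulmxKV //.
  exact: unitarymx_unit.
have -> : (v *m A *m v ^t* = w *m diag_mx d *m w ^t*)%sesqui.
  by rewrite wE [in LHS]AE invmx_unitary // /w !mulmxA.
rewrite mul_mx_diag !mxE mulr_sumr; apply: ler_sum => i _.
rewrite !mxE mulrAC [leRHS]mulrC ler_wpM2r ?Emin //.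
by rewrite mul_conjC_ge0.
Qed.

(** A ground state of the mixture serves as a trial vector for both [A] and [B]. *)
Lemma ground_energy_concave (R : realType) (m : nat) (A B : 'M[R[i]]_m) (t : R) :
  (0 < m)%N -> A \is hermsymmx -> B \is hermsymmx ->
  t%:C%C *: A + (1 - t)%:C%C *: B \is hermsymmx -> 0 <= t <= 1 ->
  t * ground_energy A + (1 - t) * ground_energy B
    <= ground_energy (t%:C%C *: A + (1 - t)%:C%C *: B).
Proof.
move=> m0 hA hB hC /andP[t0 t1]; set C := (X in ground_energy X).
have [/eigenvalueP[v vC v0] _] := ground_energyP m0 hC.
rewrite -lecR -(ler_pM2r (qform1_gt0 v0)) -(qform_eigenvector vC) qform_lin.
move: (rayleigh_ge v hA) (rayleigh_ge v hB).
move: (ground_energy A) (ground_energy B) (qform A v) (qform B v) (qform _ v).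
move=> a b qA qB q qA_ge qB_ge.
rewrite rmorphD !rmorphM /= mulrDl -!mulrA.
by apply: lerD; apply: ler_wpM2l; rewrite // ler0c // subr_ge0.
Qed.

(* Gershgorin's disc theorem for A conjugated by the diagonal matrix of f. *)
Lemma ground_energy_ge (R : realType) (m : nat) (A : 'M[R[i]]_m) (f : 'I_m -> R)
    (l : R) :
  (0 < m)%N -> A \is hermsymmx -> (forall z, 0 < f z) ->
  (forall z, (l * f z)%:C%C + \sum_(w | w != z) (f w)%:C%C * `|A w z|
             <= A z z * (f z)%:C%C) ->
  l <= ground_energy A.
Proof.
move=> m0 hA f0 fl; set a := ground_energy A.
have [/eigenvalueP[v vA v0] _] := ground_energyP m0 hA.
pose r z : R := complex.Re `|v 0 z| / f z.
have vE z : `|v 0 z| = (r z)%:C%C * (f z)%:C%C.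
  by rewrite -rmorphM /= /r divfK ?gt_eqF // RRe_real // normr_real.
have [z0 vz0] : exists z, v 0 z != 0.
  apply/existsP; apply: contraNT v0; rewrite negb_exists => /forallP v0.
  by apply/eqP/rowP => i; rewrite mxE; apply/eqP; have := v0 i; rewrite negbK.
(* At the index maximising [|v z| / f z], every other [|v w|] is at most [r z * f w], so the
   eigenvector equation in this coordinate bounds the gap between [A z z] and the eigenvalue. *)
pose z := [arg max_(z > z0) r z]%O.
have rz w : r w <= r z by rewrite /z; case: arg_maxP => // j _; apply.
have rz0 : 0 < r z.
  apply: lt_le_trans (rz z0); apply: divr_gt0 => //.
  by rewrite -ltcR RRe_real ?normr_real // normr_gt0.
have rzC : 0 < (r z)%:C%C by rewrite ltcR.
have fzC w : 0 < (f w)%:C%C by rewrite ltcR.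
have eqz : (A z z - a%:C%C) * v 0 z = - \sum_(w | w != z) v 0 w * A w z.
  have /rowP/(_ z) := vA; rewrite !mxE (bigD1 z) //= => E.
  by rewrite mulrBl -E mulrC opprD addNKr.
have bound : (A z z - a%:C%C) * (f z)%:C%C <= \sum_(w | w != z) (f w)%:C%C * `|A w z|.
  rewrite -(ler_pM2l rzC) mulrCA -vE.
  have le1 : (A z z - a%:C%C) * `|v 0 z| <= `|(A z z - a%:C%C) * v 0 z|.
    rewrite normrM ler_wpM2r //; apply: real_ler_norm.
    apply: rpredB; last by apply/complex_realP; exists a.
    apply/CrealP; have := is_hermitianmxP _ _ _ hA.
    by rewrite expr0 scale1r => /matrixP/(_ z z); rewrite !mxE => <-.
  apply: (le_trans le1); rewrite eqz normrN (le_trans (ler_norm_sum _ _ _)) //.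
  rewrite mulr_sumr; apply: ler_sum => w _.
  rewrite normrM vE mulrA ler_wpM2r // ler_wpM2r ?lecR // ltW //.
have := le_trans (lerD (lexx _) bound) (fl z).
by rewrite mulrBl addrCA gerDl subr_le0 -rmorphM lecR ler_pM2r.
Qed.

(** * Energy bounds valid for every permutation *)

(** Writing each entry as the image of one real number lets the later estimates take place in
    [R]. *)
Lemma hamiltonianE (R : realType) (n : nat) (pi : 'S_(2 ^ n)) (s : R)
    (w z : 'I_(2 ^ n)) :
  hamiltonian pi s w z
  = ((1 - s) / 2 * (n%:R * (w == z)%:R - \sum_i (w == flip i z)%:R)
     + s * (hamming_weight (pi^-1 z)%g)%:R * (w == z)%:R)%:C%C.
Proof.
rewrite !(mxE, summxE).
rewrite (eq_bigr (fun i => (2^-1 * ((w == z)%:R - (w == flip i z)%:R))%:C%C));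
  last by move=> i _; rewrite !mxE is_flipE rmorphM rmorphB !rmorph_nat fmorphV rmorph_nat.
rewrite (bigD1 z) //= [X in _ + _ * (_ + X)]big1 ?addr0 => [|u uz]; last first.
  by rewrite !mxE eq_sym in uz *; rewrite (negbTE uz) andbF mulr0.
rewrite !mxE eqxx andbT -!(rmorph_nat (real_complex R)) -rmorph_sum -!rmorphM -rmorphD.
congr (_%:C%C); rewrite -mulr_sumr sumrB sumr_const card_ord -[_ *+ n]mulr_natl !mulrA.
by rewrite /= !natrM !mulrA.
Qed.

Lemma qform_const (R : realType) (m : nat) (A : 'M[R[i]]_m) :
  qform A (const_mx 1) = \sum_z \sum_w A w z.
Proof.
rewrite /qform mxE; apply: eq_bigr => z _.
rewrite !mxE rmorph1 mulr1; apply: eq_bigr => w _.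
by rewrite mxE mul1r.
Qed.

Lemma qform_delta (R : realType) (m : nat) (A : 'M[R[i]]_m) (z : 'I_m) :
  qform A (delta_mx 0 z) = A z z.
Proof.
rewrite /qform -rowE mxE (bigD1 z) //= big1 ?addr0 => [|w wz]; rewrite !mxE.
  by rewrite !eqxx rmorph1 mulr1.
by rewrite (negbTE wz) andbF rmorph0 mulr0.
Qed.

(** Off the diagonal the entries are [-(1-s)/2] between strings differing in one bit and zero
    otherwise. Since [s <= 1], their absolute values turn the Gershgorin condition into
    [H f >= l f]. *)
Lemma hamiltonian_ge (R : realType) (n : nat) (pi : 'S_(2 ^ n)) (s : R)
    (f : 'I_(2 ^ n) -> R) (l : R) :
  s <= 1 -> (forall z, 0 < f z) ->
  (forall z, l * f z + (1 - s) / 2 * \sum_i f (flip i z)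
     <= ((1 - s) / 2 * n%:R + s * (hamming_weight (pi^-1 z)%g)%:R) * f z) ->
  l <= ground_energy (hamiltonian pi s).
Proof.
move=> s1 f0 fl; apply: (@ground_energy_ge _ _ _ f) => //.
- by rewrite expn_gt0.
- exact: hamiltonian_herm.
move=> z; rewrite hamiltonianE eqxx !mulr1 [\sum_(i < n) _]big1; last first.
  by move=> i _; rewrite eq_sym (negbTE (flip_neq i z)).
rewrite subr0 -rmorphM.
suff -> : \sum_(w | w != z) (f w)%:C%C * `|hamiltonian pi s w z|
          = ((1 - s) / 2 * \sum_i f (flip i z))%:C%C.
  by rewrite -rmorphD lecR fl.
rewrite (eq_bigr (fun w =>
  ((1 - s) / 2 * \sum_i f w * (w == flip i z)%:R)%:C%C)) => [|w wz].
  rewrite -rmorph_sum -mulr_sumr exchange_big /=; congr (_ * _)%:C%C.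
  apply: eq_bigr => i _; rewrite (bigD1 (flip i z)) ?flip_neq //=.
  rewrite eqxx mulr1 big1 ?addr0 // => w /andP[_ /negbTE->].
  by rewrite mulr0.
rewrite hamiltonianE (negbTE wz) !mulr0 addr0 sub0r mulrN.
rewrite -mulr_sumr mulrCA rmorphM /=; congr (_ * _).
rewrite rmorphN normrN ger0_norm // ler0c mulr_ge0 //; last exact: sumr_ge0.
by rewrite divr_ge0 // subr_ge0.
Qed.

Lemma hamiltonian_affine (R : realType) (n : nat) (pi : 'S_(2 ^ n)) (t a b : R) :
  hamiltonian pi (t * a + (1 - t) * b)
  = t%:C%C *: hamiltonian pi a + (1 - t)%:C%C *: hamiltonian pi b.
Proof.
apply/matrixP => w z; rewrite [RHS]mxE [X in _ = X + _]mxE [X in _ = _ + X]mxE.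
by rewrite !hamiltonianE -!rmorphM -rmorphD; congr _%:C%C; ring.
Qed.

Lemma hamiltonian_concave (R : realType) (n : nat) (pi : 'S_(2 ^ n)) (t a b : R) :
  0 <= t <= 1 ->
  t * ground_energy (hamiltonian pi a) + (1 - t) * ground_energy (hamiltonian pi b)
    <= ground_energy (hamiltonian pi (t * a + (1 - t) * b)).
Proof.
move=> t01; rewrite hamiltonian_affine ground_energy_concave ?hamiltonian_herm //.
  by rewrite expn_gt0.
by rewrite -hamiltonian_affine hamiltonian_herm.
Qed.

(** The constant function is annihilated by the hopping part, which leaves only the nonnegative
    diagonal term. *)
Lemma ground_energy_ge0 (R : realType) (n : nat) (pi : 'S_(2 ^ n)) (s : R) :
  0 <= s <= 1 -> 0 <= ground_energy (hamiltonian pi s).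
Proof.
move=> /andP[s0 s1]; apply: (@hamiltonian_ge _ _ _ _ (fun=> 1)) => // z.
by rewrite mul0r add0r mulr1 sumr_const card_ord lerDl mulr_ge0.
Qed.

Lemma ground_energy_le_uniform (R : realType) (n : nat) (pi : 'S_(2 ^ n)) (s : R) :
  ground_energy (hamiltonian pi s) <= n%:R * (s / 2).
Proof.
have N0 : 0 < (2 ^ n)%:R :> R by rewrite ltr0n expn_gt0.
rewrite -(ler_pM2r N0) -lecR.
have := rayleigh_ge (const_mx 1) (hamiltonian_herm pi s).
rewrite !qform_const.
have -> : \sum_z \sum_w (1%:M : 'M[R[i]]_(2 ^ n)) w z = (2 ^ n)%:R%:C%C.
  rewrite rmorph_nat -[in RHS](card_ord (2 ^ n)) -sumr_const.
  apply: eq_bigr => z _; rewrite (bigD1 z) //= big1 ?addr0 => [|w wz].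
    by rewrite mxE eqxx.
  by rewrite mxE (negbTE wz).
rewrite -rmorphM; move/le_trans; apply.
(* In each column the entries of the hopping part cancel, so only the diagonal weight survives; its
   total does not depend on [pi]. *)
rewrite (eq_bigr (fun z => (s * (hamming_weight (pi^-1 z)%g)%:R)%:C%C)) => [|z _].
  rewrite -rmorph_sum lecR -mulr_sumr.
  have -> : \sum_z (hamming_weight (pi^-1 z)%g)%:R
            = (\sum_(z < 2 ^ n) hamming_weight z)%:R :> R.
    by rewrite natr_sum [RHS](reindex_inj (@perm_inj _ (pi^-1)%g)).
  rewrite le_eqVlt; apply/orP; left; apply/eqP.
  have /(congr1 (fun u => u%:R : R)) := sum_hamming_weight n.
  rewrite !natrM => sumW.
  have -> : n%:R * (s / 2) * (2 ^ n)%:R = s * (n%:R * (2 ^ n)%:R) / 2 by field.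
  by rewrite -sumW; field.
rewrite (eq_bigr _ (fun w _ => hamiltonianE pi s w z)) -rmorph_sum.
congr _%:C%C; rewrite big_split /= -!mulr_sumr sumrB -mulr_sumr exchange_big /=.
have sum1 u : \sum_w (w == u)%:R = 1 :> R.
  by rewrite (bigD1 u) //= eqxx big1 ?addr0 // => w /negbTE->.
rewrite sum1 (eq_bigr (fun=> 1)) => [|i _]; last exact: sum1.
by rewrite sumr_const card_ord !mulr1 subrr mulr0 add0r.
Qed.

Lemma ground_energy_le_basis (R : realType) (n : nat) (pi : 'S_(2 ^ n)) (s : R) :
  ground_energy (hamiltonian pi s) <= n%:R * ((1 - s) / 2).
Proof.
have z0P : (0 < 2 ^ n)%N by rewrite expn_gt0.
pose z := pi (Ordinal z0P).
have := rayleigh_ge (delta_mx 0 z) (hamiltonian_herm pi s).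
rewrite !qform_delta mxE eqxx mulr1 hamiltonianE lecR permK eqxx !mulr1.
rewrite [\sum_(i < n) _]big1 => [|i _]; last first.
  by rewrite eq_sym (negbTE (flip_neq i z)).
suff -> : hamming_weight (Ordinal z0P) = 0%N by rewrite mulr0 addr0 subr0 mulrC.
by apply: big1 => i _; rewrite /bit /= div0n.
Qed.

Lemma ground_energy_le_profile (R : realType) (n : nat) (pi : 'S_(2 ^ n)) (s : R) :
  (1 <= n)%N -> ground_energy (hamiltonian pi s) / n%:R <= energy_profile s.
Proof.
move=> n1; rewrite ler_pdivrMr ?ltr0n // mulrC /energy_profile.
by case: ifP => _; [exact: ground_energy_le_uniform | exact: ground_energy_le_basis].
Qed.

(** The profile is linear on each half of the interval, with peak [1/4] at [1/2]. Writing [s] as a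
    mixture of [1/2], with weight [t], and the nearer endpoint [b], concavity keeps the share [t] of
    the energy at [1/2], and the endpoint energy is nonnegative. *)
Lemma ground_energy_ge_chord (R : realType) (n : nat) (pi : 'S_(2 ^ n)) (c : R) :
  n%:R / 4 * c <= ground_energy (hamiltonian pi (2^-1 : R)) ->
  forall s : R, 0 <= s <= 1 ->
    n%:R * (energy_profile s * c) <= ground_energy (hamiltonian pi s).
Proof.
move=> Ehalf s /andP[s0 s1].
suff [t [b [/andP[t0 t1] b01 sE eE]]] : exists t b : R,
    [/\ 0 <= t <= 1, 0 <= b <= 1, s = t * 2^-1 + (1 - t) * b
      & energy_profile s = t / 4].
  have := hamiltonian_concave pi 2^-1 b (introT andP (conj t0 t1)).
  rewrite -sE; apply: le_trans; rewrite eE.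
  rewrite (_ : _ * _ = t * (n%:R / 4 * c)); last by ring.
  rewrite -[leLHS]addr0; apply: lerD; first by rewrite ler_wpM2l.
  by apply: mulr_ge0; [rewrite subr_ge0 | exact: ground_energy_ge0].
rewrite /energy_profile; case: ifPn => [s_le|]; last rewrite -ltNge => s_gt.
  by exists (2 * s), 0; split; lra.
by exists (2 * (1 - s)), 1; split; lra.
Qed.

(** * The lower bound at [s = 1/2] and its failure probability *)

Lemma leq_card_bigcup (I T : finType) (P : pred I) (F : I -> {set T}) :
  (#|\bigcup_(i | P i) F i| <= \sum_(i | P i) #|F i|)%N.
Proof.
elim/big_rec2: _ => [|i k A _ leAk]; first by rewrite cards0.
by apply: leq_trans (leq_card_setU _ _) _; rewrite leq_add2l.
Qed.

(** The constant 5 is [3 + 2]: off the image of [S], twice the weight may fall [3 x^3] short of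
    [x^4], and neighbours in that image raise the neighbour sum of [f] by at most [2 x^3]. *)
Lemma lower_bound_of_sparse (R : realType) (n : nat) (pi : 'S_(2 ^ n)) (x : R)
    (S : {set 'I_(2 ^ n)}) :
  8 <= x -> x ^+ 4 = n%:R ->
  (forall z, (pi^-1 z)%g \notin S ->
     x ^+ 4 / 2 - 3 / 2 * x ^+ 3 <= (hamming_weight (pi^-1 z)%g)%:R) ->
  (forall z, #|[set i | (pi^-1 (flip i z))%g \in S]|%:R <= 8 * x ^+ 2) ->
  n%:R / 4 * (1 - 5 * x^-1) <= ground_energy (hamiltonian pi (2^-1 : R)).
Proof.
move=> x8 xn highW sparse.
pose f z : R := if (pi^-1 z)%g \in S then x / 4 else 1.
have -> : n%:R / 4 * (1 - 5 * x^-1) = (x ^+ 4 - 5 * x ^+ 3) / 4.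
  by rewrite -xn; field; lra.
have x2 : 0 <= x ^+ 2 by rewrite exprn_ge0 //; lra.
have x3 : 8 * x ^+ 2 <= x ^+ 3 by rewrite [x ^+ 3]exprS ler_wpM2r.
have x4 : 8 * x ^+ 3 <= x ^+ 4 by rewrite [x ^+ 4]exprS ler_wpM2r //; lra.
have nbrs z : \sum_i f (flip i z) <= x ^+ 4 + 2 * x ^+ 3 - 8 * x ^+ 2.
  set k := #|[set i | (pi^-1 (flip i z))%g \in S]|.
  have -> : \sum_i f (flip i z) = n%:R + (x / 4 - 1) * k%:R.
    rewrite (eq_bigr (fun i =>
      1 + (x / 4 - 1) * ((pi^-1 (flip i z))%g \in S)%:R)) => [|i _].
      rewrite big_split /= sumr_const card_ord -mulr_sumr; congr (_ + _ * _).
      rewrite -natr_sum /k -sum1_card [in RHS]big_mkcond /=; congr _%:R.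
      by apply: eq_bigr => i _; rewrite inE; case: (_ \in _).
    by rewrite /f; case: ifP => _ /=; ring.
  have xk : (x / 4 - 1) * k%:R <= (x / 4 - 1) * (8 * x ^+ 2).
    by rewrite ler_wpM2l ?sparse //; lra.
  have -> : x ^+ 4 + 2 * x ^+ 3 - 8 * x ^+ 2
            = n%:R + (x / 4 - 1) * (8 * x ^+ 2) by rewrite -xn; field.
  by rewrite lerD2l.
apply: (@hamiltonian_ge _ _ _ _ f); first by lra.
  by move=> z; rewrite /f; case: ifP => _; lra.
move=> z; have := nbrs z; set sumf := \sum_i _ => sumf_le.
rewrite -xn /f; case: ifPn => [_|zS].
  have W0 : 0 <= (hamming_weight (pi^-1 z)%g)%:R * x by rewrite mulr_ge0 //; lra.
  (* On the image of [S] only nonnegativity of the weight is available. The large value [x/4] of [f]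
     yields a margin [5/4 x^4], which exceeds the neighbour sum because [2 x^3 <= x^4 / 4] when
     [x >= 8]. *)
  suff : (x ^+ 4 - 5 * x ^+ 3) * x / 4 + sumf <= x ^+ 4 * x / 4 by lra.
  have -> : (x ^+ 4 - 5 * x ^+ 3) * x / 4 = x ^+ 4 * x / 4 - 5 / 4 * x ^+ 4 by field.
  lra.
have := highW z zS; lra.
Qed.

(* Any vertex with more than 8 x^2 neighbours in the image of S yields a set of that many bits whose
   flips all land in it: a union bound over vertices and sets of bits. *)
Lemma crowded_perm_count (R : realType) (n : nat) (x : R) (S : {set 'I_(2 ^ n)}) :
  1 <= x -> x ^+ 4 = n%:R -> #|S|%:R <= 2 ^+ n * expR (- x ^+ 2) ->
  #|[set pi : 'S_(2 ^ n) | [exists z,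
      8 * x ^+ 2 < #|[set i | (pi^-1 (flip i z))%g \in S]|%:R]]|%:R
    <= 2^-1 ^+ n * #|{perm 'I_(2 ^ n)}|%:R :> R.
Proof.
move=> x1 xn cardS.
pose B z (I : {set 'I_n}) : {set 'S_(2 ^ n)} :=
  [set pi : 'S_(2 ^ n) | (pi^-1 : 'S_(2 ^ n))%g @: [set flip i z | i in I] \subset S].
(* With density at most [exp(-x^2)] and more than [8 x^2] points, the probability is at most
   [exp(-8 x^4) = exp(-8 n)], and [exp 8 >= 9]. *)
have cardB z (I : {set 'I_n}) : 8 * x ^+ 2 < #|I|%:R ->
    #|B z I|%:R <= 8^-1 ^+ n * #|{perm 'I_(2 ^ n)}|%:R :> R.
  move=> ltI; set A := [set flip i z | i in I].
  have cardA : #|A| = #|I| by rewrite card_imset //; exact: flip_inj.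
  (* Inversion is a bijection on permutations, so [pi] and its inverse give the same count. *)
  have -> : #|B z I| = #|[set p : 'S_(2 ^ n) | p @: A \subset S]|.
    rewrite -(card_imset _ (@invg_inj 'S_(2 ^ n))); apply: eq_card => p.
    by rewrite -[p]invgK mem_imset ?inE //; exact: invg_inj.
  apply: (le_trans (perm_preim_count _ _ _ _)); first by rewrite card_ord expn_gt0.
  rewrite ler_wpM2r // cardA card_ord.
  have ratio : #|S|%:R / (2 ^ n)%:R <= expR (- x ^+ 2) :> R.
    by rewrite ler_pdivrMr ?ltr0n ?expn_gt0 // mulrC natrX.
  apply: (le_trans (lerXn2r _ _ _ ratio)); rewrite ?nnegrE ?expR_ge0 //.
  rewrite -expRM_natr.
  apply: (@le_trans _ _ (expR (- 8 * x ^+ 4))).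
    rewrite ler_expR mulNr mulNr lerN2.
    by rewrite (_ : 8 * x ^+ 4 = x ^+ 2 * (8 * x ^+ 2)) ?ler_wpM2l ?exprn_ge0 ?ltW //; [lra|ring].
  rewrite xn expRM_natr lerXn2r ?nnegrE ?expR_ge0 //.
  rewrite expRN lef_pV2 ?posrE ?expR_gt0 //.
  by have := expR_ge1Dx (8 : R); lra.
have sub : [set pi : 'S_(2 ^ n) | [exists z,
      8 * x ^+ 2 < #|[set i | (pi^-1 (flip i z))%g \in S]|%:R]]
    \subset \bigcup_z \bigcup_(I : {set 'I_n} | 8 * x ^+ 2 < #|I|%:R) B z I.
  apply/fintype.subsetP => pi; rewrite inE => /existsP[z ltz].
  apply/bigcupP; exists z => //; apply/bigcupP.
  exists [set i | (pi^-1 (flip i z))%g \in S] => //.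
  rewrite inE; apply/fintype.subsetP => _ /imsetP[_ /imsetP[i + ->] ->].
  by rewrite inE.
apply: (@le_trans _ _ (\sum_(z < 2 ^ n) \sum_(I : {set 'I_n} | 8 * x ^+ 2 < #|I|%:R)
    #|B z I|%:R)).
  under eq_bigr do rewrite -natr_sum.
  rewrite -natr_sum ler_nat.
  apply: leq_trans (subset_leq_card sub) _.
  apply: leq_trans (leq_card_bigcup _ _) _.
  by apply: leq_sum => z _; exact: leq_card_bigcup.
(* Allowing all [2^n] sets of bits at each of the [2^n] vertices costs [4^n] against [8^-n], leaving
   [2^-n]. *)
apply: (@le_trans _ _ (\sum_(z < 2 ^ n) \sum_(I : {set 'I_n})
   8^-1 ^+ n * #|{perm 'I_(2 ^ n)}|%:R)).
  apply: ler_sum => z _; rewrite [leLHS]big_mkcond; apply: ler_sum => I _.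
  by case: ifP => [/cardB//|_]; rewrite mulr_ge0 ?exprn_ge0.
have card_bits : #|{set 'I_n}| = (2 ^ n)%N.
  by rewrite -cardsT -powersetT card_powerset cardsT card_ord.
rewrite !sumr_const card_ord card_bits -!mulrnA -[X in X <= _]mulr_natr natrM natrX.
set P := #|_|%:R; rewrite [X in X <= _](_ : _ = (8^-1 * (2 * 2)) ^+ n * P).
  by rewrite ler_wpM2r // lerXn2r ?nnegrE //; lra.
by rewrite !exprMn; ring.
Qed.

(** * Uniform bounds in [s] and the limit in [n] *)

Local Open Scope classical_set_scope.

Theorem theorem1 (R : realType) :
  (forall (n : nat) (pi : 'S_(2 ^ n)) (s : R),
     (1 <= n)%N -> 0 <= s <= 1 ->
     ground_energy (hamiltonian pi s) / n%:R <= energy_profile s)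
  /\
  (fun n : nat =>
     uniform_prob_of R (fun pi : 'S_(2 ^ n) =>
       forall s : R, 0 <= s <= 1 ->
         energy_profile s * (1 - 5 * n%:R `^ (- 4^-1))
           <= ground_energy (hamiltonian pi s) / n%:R))
    @ \oo --> (1 : R).
Proof.
split; first by move=> n pi s n1 _; exact: ground_energy_le_profile.
(* The good event contains the complement of the crowded permutations. That complement does not
   depend on [s], so one exceptional set serves all [s] at once. *)
apply: (@squeeze_cvgr _ _ _ _ (fun n => 1 - 2^-1 ^+ n : R) (cst 1)).
- near=> n.
  (* Here [4096 = 8^4], which gives [x >= 8] for [x = n^(1/4)]. *)
  have n1 : (4096 <= n)%N by near: n; exact: nbhs_infty_ge.
  have n0 : 0 < n%:R :> R by rewrite ltr0n (leq_trans _ n1).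
  have perm0 : 0 < #|{perm 'I_(2 ^ n)}|%:R :> R.
    by rewrite ltr0n; apply/card_gt0P; exists 1%g.
  apply/andP; split; last first.
    by rewrite ler_pdivrMr // mul1r ler_nat max_card.
  pose x : R := n%:R `^ 4^-1.
  have xn : x ^+ 4 = n%:R.
    by rewrite -powR_mulrn ?powR_ge0 // -powRrM mulVf // powRr1 // ltW.
  have x8 : 8 <= x.
    rewrite -(@ler_pXn2r _ 4) ?nnegrE ?powR_ge0 // xn -natrX ler_nat.
    exact: n1.
  have x1 : 1 <= x by lra.
  have xV : n%:R `^ (- 4^-1) = x^-1 by rewrite powRN.
  pose S : {set 'I_(2 ^ n)} := [set z |
    (hamming_weight z)%:R < x ^+ 4 / 2 - 3 / 2 * x ^+ 3]%SET.
  have := crowded_perm_count x1 xn (low_weight_tail x1 xn).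
  rewrite -/S; set bad := finset _ => badP.
  rewrite /uniform_prob_of ler_pdivlMr // mulrBl mul1r lerBlDr.
  apply: le_trans (lerD (lexx _) badP).
  rewrite -natrD ler_nat.
  rewrite -(cardsC bad) addnC leq_add2r; apply: subset_leq_card.
  apply/fintype.subsetP => pi; rewrite !inE negb_exists => /forallP good.
  move=> s s01.
  rewrite ler_pdivlMr // mulrC xV; apply: ground_energy_ge_chord s01.
  apply: (lower_bound_of_sparse (S := S)) => // z.
    by rewrite inE -leNgt.
  by rewrite leNgt.
- rewrite -[X in _ --> X]subr0; apply: cvgB; first exact: cvg_cst.
  by apply: cvg_expr; rewrite ger0_norm; lra.
- exact: cvg_cst.
Unshelve. all: by end_near.
Qed.
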